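(* Let $p$ be an odd prime, $l\ge1$ and $d\ge 1$ integers, $q=p^l$, let $A\subset\mathbb{Z}_q$ and $E=A\times\cdots\times A\subset\mathbb{Z}_q^d$ ($d$-fold product). There is a constant $c>0$ independent of $p$, $l$ and $A$ (depending at most on $d$) such that if $|E|\geq q^{d\left(\frac{2l-1}{2l}\right)+\frac{1}{2l}}$, then $|\Pi(E)|\geq c\,q$.
   Context: $\mathbb{Z}_q$ denotes the ring of integers modulo $q$. For $x,y\in\mathbb{Z}_q^d$, $x\cdot y=x_1y_1+\dots+x_dy_d$ in $\mathbb{Z}_q$, and $\Pi(E)=\{x\cdot y: x,y\in E\}$ is the dot product set. The paper writes the conclusion as $\Pi(E)\gtrsim q$. *)

(* Defs.v *)
From mathcomp Require Import all_boot all_order all_algebra.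
Set Implicit Arguments.
Unset Strict Implicit.
Unset Printing Implicit Defensive.
Import GRing.Theory.
Local Open Scope ring_scope.

(* Z_q is rendered by 'Z_q, which is the ring of integers modulo q only when
   1 < q; the definitions below are only used for such q. *)

Definition dotp (q d : nat) (x y : 'rV['Z_q]_d) : 'Z_q :=
  \sum_(i < d) x 0 i * y 0 i.

Definition dot_product_set (q d : nat) (E : {set 'rV['Z_q]_d}) : {set 'Z_q} :=
  [set dotp x y | x in E, y in E].

Definition cartesian_power (q d : nat) (A : {set 'Z_q}) : {set 'rV['Z_q]_d} :=
  [set x : 'rV['Z_q]_d | [forall i : 'I_d, x 0 i \in A]].

(* Main.v *)
Require Import Defs.
From mathcomp Require Import all_boot all_order all_algebra.
From mathcomp Require Import reals exp.
From mathcomp Require Import zify ring lra.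
Import Order.TTheory GRing.Theory Num.Theory.
Local Open Scope ring_scope.

(* For x in Z_q^d let T(x) be the number of pairs (y, y') in E^2 with
   x.y = x.y'. By Cauchy-Schwarz |E|^2 <= |Pi(E)| T(x) for x in E, and
   q T(x) - |E|^2 >= 0 for every x. Because of this positivity, the sum of
   q T(x) - |E|^2 over x in E is at most its sum over all x in Z_q^d, and the
   latter only involves the numbers of x orthogonal to a given y - y'. If p^k
   is the largest power of p dividing z, then z is orthogonal to at most
   q^(d-1) p^k vectors, and at most p^((l-i)d) vectors are divisible by p^i, so
   this sum is at most q^d |E| times the sum over 1 <= i <= l of p^(i+(l-i)d).
   For d >= 2 the term i = 1 dominates this geometric sum, and the hypothesis
   on |E| says exactly that q^d p^(1+(l-1)d) <= |E|^2, whence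
   q <= 3 |Pi(E)|. For d = 1 the hypothesis forces E to be everything. *)

(** * Collisions of a map, and a geometric sum *)

Section Counting.
Local Open Scope nat_scope.

Lemma leq_sum_sqr_card (T : finType) (P : {set T}) (n : T -> nat) :
  (\sum_(t in P) n t) ^ 2 <= #|P| * \sum_(t in P) n t ^ 2.
Proof.
rewrite -(leq_pmul2l (isT : 0 < 2)) expnS expn1 big_distrlr /= big_distrr /=.
have -> : 2 * (#|P| * \sum_(t in P) n t ^ 2) =
    \sum_(s in P) \sum_(t in P) (n s ^ 2 + n t ^ 2).
  under [RHS]eq_bigr do rewrite big_split /= sum_nat_const.
  by rewrite big_split /= sum_nat_const -big_distrr /= mul2n addnn.
apply: leq_sum => s _; rewrite big_distrr /=.
by apply: leq_sum => t _; rewrite nat_Cauchy.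
Qed.

(** Cauchy-Schwarz over the values in [P]: the collision count is the sum of the squared fibre sizes
    of [f] on [E]. *)
Lemma leq_card_sqr_collisions (S T : finType) (E : {set S}) (P : {set T})
    (f : S -> T) : {in E, forall y, f y \in P} ->
  #|E| ^ 2 <= #|P| * \sum_(y in E) \sum_(y' in E) (f y == f y').
Proof.
move=> fP.
have dE (g : S -> nat) :
    \sum_(y in E) g y = \sum_(t in P) \sum_(y in E | f y == t) g y.
  exact: partition_big.
have -> : \sum_(y in E) \sum_(y' in E) (f y == f y') =
          \sum_(t in P) (\sum_(y in E | f y == t) 1) ^ 2.
  rewrite dE; apply: eq_bigr => t _.
  rewrite expnS expn1 big_distrl /=; apply: eq_bigr => y /andP[_ /eqP->].
  rewrite mul1n [RHS]big_mkcondr /=; apply: eq_bigr => y' _.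
  by rewrite eq_sym; case: eqP.
have -> : #|E| = \sum_(t in P) \sum_(y in E | f y == t) 1.
  by rewrite -dE sum1_card.
exact: leq_sum_sqr_card.
Qed.

(** Without its term [i = 0], the sum for [l.+1] is [p] times the sum for [l]; the induction closes
    because [2 * p <= p ^ d]. *)
Lemma geom_weight_sum (p d l : nat) : 2 <= p -> 2 <= d ->
  \sum_(i < l.+1) p ^ (i.+1 + (l - i) * d) <= 2 * p ^ (1 + l * d).
Proof.
move=> p2 d2; elim: l => [|l IH].
  by rewrite big_ord1 /= -[X in X <= _]mul1n leq_mul2r orbT.
rewrite big_ord_recl /=.
have -> : \sum_(i < l.+1) p ^ ((bump 0 i).+1 + (l.+1 - bump 0 i) * d) =
          p * \sum_(i < l.+1) p ^ (i.+1 + (l - i) * d).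
  by rewrite big_distrr /=; apply: eq_bigr => i _; rewrite -expnS.
rewrite subn0 mul2n -addnn leq_add2l.
apply: leq_trans (leq_mul (leqnn p) IH) _.
have le1 : 2 * p ^ (1 + l * d) <= p * p ^ (1 + l * d) by rewrite leq_mul2r p2 orbT.
apply: leq_trans (leq_mul (leqnn p) le1) _.
rewrite -!expnS; apply: leq_pexp2l; lia.
Qed.

End Counting.

(** * Divisibility by powers of [p] and orthogonality *)

Section Annihilators.
Variables (p l d : nat).
Hypotheses (pp : prime p) (l_gt0 : (0 < l)%N).
Notation q := (p ^ l)%N.
Notation V := 'rV['Z_q]_d.
Implicit Types x y z : V.

Lemma prime_pow_gt1 : (1 < q)%N.
Proof. by rewrite -(exp1n l) ltn_exp2r ?prime_gt1. Qed.
Let q_gt1 := prime_pow_gt1.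

Lemma card_Zq : #|[set: 'Z_q]| = q.
Proof. by rewrite cardsT card_ord Zp_cast. Qed.

Lemma card_Zq_rV : #|{: V}| = (q ^ d)%N.
Proof. by rewrite card_mx mul1n card_ord Zp_cast. Qed.

Lemma ltn_Zq (a : 'Z_q) : (a < q)%N.
Proof. by rewrite -[X in (_ < X)%N]Zp_cast. Qed.

Lemma Zq_eq (a b : nat) : (a%:R == b%:R :> 'Z_q) = (a == b %[mod q])%N.
Proof. by rewrite -val_eqE /= !val_Zp_nat. Qed.

Lemma dotpDl x y z : dotp (x + y) z = dotp x z + dotp y z.
Proof.
by rewrite /dotp -big_split; apply: eq_bigr => i _; rewrite mxE mulrDl.
Qed.

Lemma dotpBr x y z : dotp x (y - z) = dotp x y - dotp x z.
Proof.
by rewrite /dotp -sumrB; apply: eq_bigr => i _; rewrite !mxE mulrBr.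
Qed.

Lemma dotp_delta (a : 'Z_q) i z : dotp (a *: delta_mx 0 i) z = a * z 0 i.
Proof.
rewrite /dotp (bigD1 i) //= big1 => [|j ji]; last first.
  by rewrite !mxE eqxx (negPf ji) mulr0 mul0r.
by rewrite !mxE !eqxx mulr1 addr0.
Qed.

Definition dvdv k z := [forall j, (p ^ k %| val (z 0%R j))%N].

Lemma card_dvdv k : (k <= l)%N -> (#|[set z | dvdv k z]| <= p ^ ((l - k) * d))%N.
Proof.
move=> kl; have p0 : (0 < p)%N by exact: prime_gt0.
have lt_quo (a : 'Z_q) : (a %/ p ^ k < p ^ (l - k))%N.
  by rewrite ltn_divLR ?expn_gt0 ?p0 // -expnD subnK ?ltn_Zq.
pose F z := [ffun j => Ordinal (lt_quo (z 0 j))].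
have injF : {in [set z | dvdv k z] &, injective F}.
  move=> z z'; rewrite !inE => /forallP zk /forallP zk' /ffunP eqF.
  apply/rowP => j; apply/val_inj; have := congr1 val (eqF j).
  rewrite !ffunE /= => eqj.
  by rewrite /= -(divnK (zk j)) -(divnK (zk' j)) eqj.
rewrite -(card_in_imset injF); apply: leq_trans (max_card _) _.
by rewrite card_ffun !card_ord expnM.
Qed.

Definition annihilator z : {set V} := [set x | dotp x z == 0].

(* Translating along a coordinate of [z] of exact valuation [k] gives
   [p ^ (l - k)] disjoint copies of the annihilator of [z]. *)
Lemma card_annihilator_exact k z : (k < l)%N -> dvdv k z -> ~~ dvdv k.+1 z ->
  (#|annihilator z| * p ^ (l - k) <= q ^ d)%N.
Proof.
move=> kl /forallP zk /forallPn[i zki].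
have p0 : (0 < p)%N by exact: prime_gt0.
pose F (u : V * 'I_(p ^ (l - k))) : V := u.1 + (u.2 : nat)%:R *: delta_mx 0 i.
pose D := setX (annihilator z) [set: 'I_(p ^ (l - k))].
have injF : {in D &, injective F}.
  move=> [x a] [x' a']; rewrite !in_setX !inE !andbT /= => /eqP xz /eqP xz' eqF.
  (* Pairing with [z] kills the annihilator parts and leaves [a * z 0 i = a' * z 0 i] modulo [q].
     Cancelling [p ^ k], then the unit [m], gives [a = a'] modulo [p ^ (l - k)]. *)
  have := congr1 (fun v => dotp v z) eqF.
  rewrite /F /= !dotpDl xz xz' !add0r !dotp_delta -[z 0 i]natr_Zp -!natrM.
  have [m zi] := dvdnP (zk i); move/eqP; rewrite Zq_eq zi.
  have pm : coprime (p ^ (l - k)) m.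
    rewrite coprimeXl // prime_coprime //.
    by apply: contra zki => pm; rewrite zi expnS dvdn_mul.
  have {1 2}-> : q = (p ^ (l - k) * p ^ k)%N by rewrite -expnD subnK // ltnW.
  rewrite !mulnA -!muln_modl eqn_pmul2r ?expn_gt0 ?p0 //.
  have eqa : (a * m == a' * m %[mod p ^ (l - k)] -> a = a' :> nat)%N.
    wlog le_aa' : a a' {eqF} / (a' <= a)%N.
      move=> W; have [|/ltnW] := leqP a' a; first exact: W.
      by move=> le /eqP/esym/eqP /(W _ _ le).
    rewrite eqn_mod_dvd ?leq_mul2r ?le_aa' ?orbT // -mulnBl Gauss_dvdl //.
    move=> /dvdn_leq; have := ltn_ord a; lia.
  move/eqa/val_inj => eaa'; move: eqF; rewrite /F /= eaa'.
  by move/addIr => ->.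
have := card_in_imset injF; rewrite cardsX cardsT card_ord => <-.
by rewrite -card_Zq_rV max_card.
Qed.

(** The weight on the right dominates [p ^ k] for the largest [k <= l] with [dvdv k z]. Being linear
    in divisibility indicators, it can be summed over differences one exponent at a time. *)
Lemma card_annihilator z :
  (q * #|annihilator z| <=
     q ^ d * (1 + \sum_(i < l) p ^ i.+1 * dvdv i.+1 z))%N.
Proof.
have p0 : (0 < p)%N by exact: prime_gt0.
have key k : (k <= l)%N -> dvdv k z ->
    (p ^ k <= 1 + \sum_(i < l) p ^ i.+1 * dvdv i.+1 z)%N.
  case: k => [|k] kl zk; first by rewrite expn0.
  by rewrite (bigD1 (Ordinal kl)) //= zk muln1 addnCA leq_addr.
have [zl|nzl] := boolP (dvdv l z).
  rewrite mulnC leq_mul ?key //.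
  by rewrite -card_Zq_rV max_card.
have z0 : dvdv 0 z by apply/forallP => j; rewrite expn0 dvd1n.
have [k [kl zk zk1]] : exists k, [/\ (k < l)%N, dvdv k z & ~~ dvdv k.+1 z].
  have ex m : (m <= l)%N -> ~~ dvdv m z ->
      exists k, [/\ (k < l)%N, dvdv k z & ~~ dvdv k.+1 z].
    elim: m => [|m IH] ml nzm; first by rewrite z0 in nzm.
    have [zm|nzm'] := boolP (dvdv m z); first by exists m.
    exact: IH (ltnW ml) nzm'.
  exact: ex (leqnn l) nzl.
have := card_annihilator_exact k z kl zk zk1; set N := #|_| => leN.
rewrite -{1}(subnK (ltnW kl)) expnD mulnC mulnA.
by apply: leq_mul => //; exact: key (ltnW kl) zk.
Qed.

Lemma dot_product_set_lower_bound (E : {set V}) : (2 <= d)%N ->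
  (p ^ (l * d + (1 + l.-1 * d)) <= #|E| ^ 2)%N ->
  (q <= 3 * #|dot_product_set E|)%N.
Proof.
move=> d2 largeE.
have p2 : (2 <= p)%N by exact: prime_gt1.
have p0 : (0 < p)%N by exact: prime_gt0.
have E0 : (0 < #|E|)%N.
  by rewrite -(@ltn_exp2r _ _ 2) // (leq_trans _ largeE) ?expn_gt0 ?p0.
pose T x := (\sum_(y in E) \sum_(y' in E) (dotp x y == dotp x y'))%N.
have CSq x : (#|E| ^ 2 <= q * T x)%N.
  have := leq_card_sqr_collisions _ _ E setT (dotp x) (fun _ _ => in_setT _).
  by rewrite card_Zq.
have CSP x : x \in E -> (#|E| ^ 2 <= #|dot_product_set E| * T x)%N.
  move=> xE; apply: leq_card_sqr_collisions => y yE.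
  by apply/imset2P; exists x y.
have sumT : (\sum_x q * T x <= q ^ d * #|E| ^ 2 +
    q ^ d * #|E| * (2 * p ^ (1 + l.-1 * d)))%N.
  have -> : (\sum_x q * T x = \sum_(y in E) \sum_(y' in E)
      q * #|annihilator (y - y')%R|)%N.
    rewrite -big_distrr /= exchange_big /= big_distrr; apply: eq_bigr => y _.
    rewrite exchange_big /= big_distrr; apply: eq_bigr => y' _ /=.
    congr (_ * _)%N; rewrite -sum1_card [RHS]big_mkcond /=.
    by apply: eq_bigr => x _; rewrite inE dotpBr subr_eq0; case: eqP.
  apply: (@leq_trans (\sum_(y in E) (q ^ d * #|E| +
      q ^ d * (2 * p ^ (1 + l.-1 * d)))))%N; last first.
    by rewrite sum_nat_const; apply/eq_leq; ring.
  apply: leq_sum => y _.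
  apply: leq_trans (leq_sum _ (fun y' _ => card_annihilator (y - y'))) _.
  rewrite -big_distrr /= -mulnDr leq_mul2l; apply/orP; right.
  rewrite big_split /= sum1_card leq_add2l exchange_big /=.
  have := geom_weight_sum p d l.-1 p2 d2; rewrite prednK //.
  apply: leq_trans; apply: leq_sum => i _.
  rewrite -big_distrr /= expnD leq_mul2l; apply/orP; right.
  have -> : (l.-1 - i = l - i.+1)%N by lia.
  apply: leq_trans (card_dvdv i.+1 (ltn_ord i)).
  rewrite -[X in (X <= _)%N]big_mkcondr /= sum1_card.
  (* For fixed [y], the map from [y'] to [y - y'] is injective, so the count is at most that of all
     vectors divisible by [p ^ i.+1]. *)
  rewrite -(card_imset _ (inj_comp (@addrI _ y) (@oppr_inj _))).
  apply/subset_leq_card/subsetP => z /imsetP[y' /andP[_ zi] ->].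
  by rewrite inE.
have sumE : (\sum_(x in E) q * T x <= 3 * #|E| ^ 3)%N.
  (* Positivity outside [E]: each such [x] contributes at least [#|E| ^ 2]. *)
  have compl : ((q ^ d - #|E|) * #|E| ^ 2 <= \sum_(x | x \notin E) q * T x)%N.
    have -> : (q ^ d - #|E| = #|~: E|)%N by rewrite [RHS]cardsCs setCK card_Zq_rV.
    rewrite -sum_nat_const; under eq_bigl do rewrite inE.
    by apply: leq_sum => x _.
  have leE : (#|E| <= q ^ d)%N by rewrite -card_Zq_rV max_card.
  have bigE : (q ^ d * p ^ (1 + l.-1 * d) <= #|E| ^ 2)%N.
    by rewrite -expnM -expnD.
  move: sumT; rewrite (bigID (mem E)) /= => sumT.
  have := leq_mul (leqnn #|E|) bigE; move: sumT compl leE.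
  set S1 := (\sum_(x in E) _)%N; set S2 := (\sum_(x | _) _)%N.
  move: #|E| S1 S2 (q ^ d)%N (p ^ (1 + _))%N => e S1 S2 Q r.
  (* Subtracting [S2 >= (Q - e) * e ^ 2] from the bound on [S1 + S2] leaves
     [S1 <= e ^ 3 + 2 * e * (Q * r)], and [Q * r <= e ^ 2]. *)
  rewrite mulnBl; nia.
have sumP : (#|E| ^ 3 <= #|dot_product_set E| * \sum_(x in E) T x)%N.
  rewrite expnS -sum_nat_const big_distrr /=.
  by apply: leq_sum => x xE; exact: CSP.
have E3 : (0 < #|E| ^ 3)%N by rewrite expn_gt0 E0.
rewrite -(leq_pmul2r E3); apply: leq_trans (leq_mul (leqnn q) sumP) _.
rewrite mulnCA [(3 * _)%N]mulnC -mulnA leq_mul2l.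
by rewrite big_distrr /= sumE orbT.
Qed.

End Annihilators.

Theorem theorem1p3 (R : realType) (d : nat) (hd : (1 <= d)%N) :
  exists c : R, 0 < c /\
    forall (p l : nat), prime p -> odd p -> (1 <= l)%N ->
    forall A : {set 'Z_(p ^ l)%N},
      let q : R := (p ^ l)%N%:R in
      let E := cartesian_power d A in
      q `^ (d%:R * ((2 * l%:R - 1) / (2 * l%:R)) + 1 / (2 * l%:R)) <= #|E|%:R ->
      c * q <= #|dot_product_set E|%:R.
Proof.
exists (1 / 3); split; first by lra.
move=> p l pp _ l0 A q E largeE.
have p0 : 0 <= p%:R :> R by rewrite ler0n.
have l0R : l%:R != 0 :> R by rewrite pnatr_eq0 -lt0n.
(* Squaring clears the denominator [2 * l]: as a power of [p], the squared bound has exponent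
   [d * (2 * l - 1) + 1]. *)
have {largeE}largeE : (p ^ (l * d + (1 + l.-1 * d)) <= #|E| ^ 2)%N.
  rewrite -(ler_nat R) !natrX.
  have := @ler_pM R _ _ _ _ (powR_ge0 _ _) (powR_ge0 _ _) largeE largeE.
  rewrite -[leRHS]expr2 -powRD; last first.
    by rewrite pnatr_eq0 expn_eq0 eqn0Ngt prime_gt0 ?implybT.
  apply: le_trans; rewrite /q natrX -!powR_mulrn // -powRrM.
  rewrite le_eqVlt; apply/orP; left; apply/eqP; congr powR.
  rewrite !natrD !natrM.
  have -> : l.-1%:R = l%:R - 1 :> R by rewrite -subn1 natrB.
  by field.
have [d2|d1] := leqP 2 d.
  have := dot_product_set_lower_bound p l d pp l0 E d2 largeE.
  rewrite -(ler_nat R) natrM -/q; lra.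
have {hd d1} d1 : d = 1%N by lia.
(* For [d = 1] that exponent is [2 * l], so [#|E|] is at least [q]; every [t] is then the product of
   [t] and [1]. *)
subst d; have ET : E = setT.
  apply/eqP; rewrite eqEcard subsetT cardsT card_Zq_rV // expn1.
  rewrite -(@leq_exp2r _ _ 2) // (leq_trans _ largeE) // -expnM.
  by rewrite leq_eqVlt; apply/orP; left; apply/eqP; congr expn; lia.
have -> : dot_product_set E = setT.
  apply/setP => t; rewrite in_setT; apply/imset2P.
  exists (t *: delta_mx 0 0) (const_mx 1); rewrite ?ET ?in_setT //.
  by rewrite dotp_delta mxE mulr1.
rewrite card_Zq // -/q.
have : 0 <= q by rewrite ler0n.
lra.
Qed.
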